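(* For every $\alpha\in[2,10/3]$ we have $b(\alpha)\le 1-0.3546(\alpha-2)$. In particular $b(3)\le 0.6454$ and $a(3)\le 1.2908$.
   Context: A graph means a finite graph, possibly with multiple (parallel) edges; each edge is a unit resistor, and $R_{xy}$ denotes effective resistance ($R_{xx}=0$; $R_{xy}=\infty$ if $x,y$ lie in different components). $e(G)$ is the number of edges. For an (unrooted) graph $G$ on $n$ vertices, $A'(G)=\frac1{n^2}\sum_{x,y\in V(G)}R_{xy}$. For a graph $G$ with a designated root vertex $\rho$, $B(G)=\frac{1}{|V(G)|-1}\sum_{x\in V(G)}R_{\rho x}$. Define $$a_n(\alpha)=\min\{A'(G):|V(G)|=n,\ e(G)\le \alpha n/2\},$$ $$b_n(\alpha)=\min\{B(G): G\text{ rooted},\ |V(G)|=n+1,\ e(G)\le \alpha n/2\},$$ and $a(\alpha)=\lim_{n\to\infty}a_n(\alpha)$, $b(\alpha)=\lim_{n\to\infty}b_n(\alpha)$; these limits exist for every $\alpha\ge 2$. *)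

(* Defs.v *)
From HB Require Import structures.
From mathcomp Require Import all_boot all_order all_algebra.
From mathcomp Require Import all_classical all_reals all_analysis.

Set Implicit Arguments.
Unset Strict Implicit.
Unset Printing Implicit Defensive.

Import Order.TTheory GRing.Theory Num.Theory.
Import numFieldNormedType.Exports.

Local Open Scope classical_set_scope.
Local Open Scope ring_scope.

(* Finite loopless multigraphs: parallel edges are distinct elements of [edge].
   The orientation given by [src] and [dst] is arbitrary; it only fixes the
   sign of the current through each edge. *)
Record multigraph := Multigraph {
  vertex : finType;
  edge : finType;
  src : edge -> vertex;
  dst : edge -> vertex;
  src_neq_dst : forall e, src e != dst e
}.

Section Resistance.
Variable R : realType.
Implicit Types G : multigraph.

Definition adjacent G : rel (vertex G) := fun x y =>
  [exists e : edge G, ((src e == x) && (dst e == y))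
                   || ((src e == y) && (dst e == x))].

(* Ohm's law for unit resistors: the current through [e], from [src e] to
   [dst e], is the potential drop. *)
Definition current G (v : vertex G -> R) (e : edge G) : R :=
  v (src e) - v (dst e).

Definition net_outflow G (v : vertex G -> R) (z : vertex G) : R :=
  \sum_(e | src e == z) current v e - \sum_(e | dst e == z) current v e.

(* Kirchhoff's law when a unit current enters at [x] and leaves at [y]. *)
Definition unit_current_potential G (x y : vertex G) (v : vertex G -> R) : Prop :=
  forall z, net_outflow v z = (z == x)%:R - (z == y)%:R.

(* If [x] and [y] are connected, such a potential exists and its drop from [x]
   to [y] does not depend on the choice made by [xget]. *)
Definition resistance G (x y : vertex G) : \bar R :=
  if connect (@adjacent G) x y then
    let v := xget (fun=> 0) [set v | unit_current_potential x y v] in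
    (v x - v y)%:E
  else +oo%E.

Definition mean_resistance G : \bar R :=
  (((#|vertex G|%:R ^+ 2)^-1)%:E *
     \sum_(x : vertex G) \sum_(y : vertex G) resistance x y)%E.

Definition rooted_mean_resistance G (rho : vertex G) : \bar R :=
  (((#|vertex G|%:R - 1)^-1)%:E * \sum_(x : vertex G) resistance rho x)%E.

(* The number of vertices is fixed and the number of edges bounded, so there
   are finitely many graphs up to isomorphism and, whenever one is admissible,
   the two infima below are minima. *)
Definition a_min (n : nat) (alpha : R) : \bar R :=
  ereal_inf [set r | exists G : multigraph,
    [/\ #|vertex G| = n, #|edge G|%:R <= alpha * n%:R / 2 & r = mean_resistance G]].

Definition b_min (n : nat) (alpha : R) : \bar R :=
  ereal_inf [set r | exists (G : multigraph) (rho : vertex G),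
    [/\ #|vertex G| = n.+1, #|edge G|%:R <= alpha * n%:R / 2 & r = rooted_mean_resistance rho]].

(* Both sequences converge for [2 <= alpha], so there [limn] is the actual limit
   rather than its default value. *)
Definition a_lim (alpha : R) : \bar R := limn (fun n => a_min n alpha).

Definition b_lim (alpha : R) : \bar R := limn (fun n => b_min n alpha).

End Resistance.

(* Main.v *)
Require Import Defs.
From mathcomp Require Import all_boot all_order all_algebra.
From mathcomp Require Import all_classical all_reals all_analysis.
From mathcomp Require Import ring lra zify.

Import Order.TTheory GRing.Theory Num.Theory.
Import numFieldNormedType.Exports.

Set Implicit Arguments.
Unset Strict Implicit.
Unset Printing Implicit Defensive.

Local Open Scope ring_scope.

(* By Thomson's principle the energy of a unit flow from x to the root bounds
   their effective resistance, so it suffices to exhibit flows of small total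
   energy.  Rooted graphs may be glued at their roots: copies of one graph with
   k non-root vertices, m edges and total energy S, together with pendant
   edges, give b(alpha) <= 1 - (alpha/2 - 1) (k - S)/(m - k) for
   2 <= alpha <= 2m/k.

   The efficient graphs look locally like the tree in which every vertex of
   degree 4 has only neighbours of degree 3, and every vertex of degree 3 has
   two neighbours of degree 4 and one of degree 3; thus the mean degree is
   10/3.  On that tree a current from x escaping to infinity, split almost
   optimally at each vertex, has energy less than 0.52720 on average over x.
   A long path of three-vertex cells with both ends at the root has the right
   degrees.  Lifting it repeatedly with voltages in (Z/2)^edges destroys all
   short cycles, without changing the proportion of edges at the root.  In such
   a lift the current spreads as in the tree for many steps, after which its
   pieces are so small that they can follow arbitrary paths to the root at
   negligible cost.  For a(3), the difference of the flows of x and y is a flow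
   from x to y; averaging the energy over all pairs gives at most twice the
   mean energy. *)

(** * Walks without backtracking *)

(* A graph rooted at [None]: every edge consists of two opposite darts, exactly
   one of which is [forward]. *)
Record dart_graph := DartGraph {
  inner : finType;
  dart : finType;
  flip : dart -> dart;
  start : dart -> option inner;
  forward : pred dart;
  flipK : involutive flip;
  forward_flip : forall d, forward (flip d) = ~~ forward d;
  start_flip_neq : forall d, start (flip d) != start d
}.

Section Turns.
Variable G : dart_graph.
Implicit Types (d c : dart G) (x z : inner G).

Lemma flip_inj : injective (@flip G).
Proof. exact: inv_inj (@flipK G). Qed.

Definition turn : rel (dart G) := fun d d' =>
  [&& start d' != None, start d' == start (flip d) & d' != flip d].

(** A walk may end at the root but not pass through it, so this forbids only the cycles of length at
    most [n] that avoid the root. *)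
Definition tree_like n := forall d s,
  path turn d s -> (size s < n)%N -> start d != None ->
  start (flip (last d s)) != start d.

Fixpoint reach x k : pred (dart G) :=
  if k is k'.+1 then fun d' => [exists d, reach x k' d && turn d d']
  else fun d => start d == Some x.

Lemma reach_path x k d : reach x k d ->
  exists c s, [/\ start c = Some x, path turn c s, last c s = d & size s = k].
Proof.
elim: k d => [|k IHk] d /=; first by move=> /eqP dx; exists d, [::].
case/existsP=> d1 /andP[/IHk[c [s [cx cs <- <-]]] d1d].
by exists c, (rcons s d); rewrite rcons_path cs last_rcons size_rcons.
Qed.

(** If the last darts differed, the first walk followed by the second one backwards would be a short
    closed walk at [x]. The induction moves the second walk, dart by dart and reversed, to the end
    of the first. *)
Lemma no_collision n x k a s c : tree_like n -> reach x k c ->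
  start a = Some x -> path turn a s -> (size s + k + 1 < n)%N ->
  start (flip c) != None -> start (flip (last a s)) = start (flip c) ->
  last a s = c.
Proof.
move=> tree + ax; elim: k c s => [|k IHk] c s /= rc as_ szn c0 ec;
  apply/eqP; apply: contraT => sc; have turn_c : turn (last a s) (flip c)
    by rewrite /turn c0 ec eqxx (inj_eq flip_inj) eq_sym.
  have /(tree a) : path turn a (rcons s (flip c)) by rewrite rcons_path as_.
  rewrite size_rcons last_rcons flipK (eqP rc) ax eqxx.
  by move=> E; apply: E => //; move: szn; lia.
case/existsP: rc => c' /andP[rc' /and3P[c0' ec' cc']].
have := IHk c' (rcons s (flip c)) rc'.
rewrite rcons_path as_ turn_c size_rcons last_rcons flipK => /(_ isT).
rewrite -(eqP ec') c0' => E; have fcc' : flip c = c' by apply: E => //; lia.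
by rewrite -fcc' flipK eqxx in cc'.
Qed.

Variables (n : nat) (x : inner G).
Hypothesis tree : tree_like n.

Lemma reach_not_back k d : reach x k d -> (k < n)%N -> start (flip d) <> Some x.
Proof.
case/reach_path=> c [s [cx cs <- <-]] szn.
by have := tree cs szn; rewrite cx => /(_ isT)/eqP.
Qed.

Lemma reach_end_inj j k d c : reach x j d -> reach x k c ->
  (j + k + 1 < n)%N -> start (flip c) != None ->
  start (flip d) = start (flip c) -> d = c.
Proof.
case/reach_path=> a [s [ax as_ <- <-]] rc szn c0 ec.
exact: (no_collision tree rc).
Qed.

(** By [reach_end_inj] two walks ending in [d] also share the dart before it. Tracing them back,
    walks of different lengths would leave a closed walk at [x]. *)
Lemma reach_level_inj j k d : reach x j d -> reach x k d ->
  (j + k < n)%N -> j = k.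
Proof.
elim: j k d => [|j IHj] [|k] d //=.
- move=> /eqP dx /existsP[c /andP[rc /and3P[_ /eqP ec _]]] kn.
  by case: (reach_not_back rc); rewrite -?ec //; lia.
- move=> /existsP[c /andP[rc /and3P[_ /eqP ec _]]] /eqP dx kn.
  by case: (reach_not_back rc); rewrite -?ec //; lia.
move=> /existsP[c /andP[rc /and3P[c0 /eqP ec _]]].
move=> /existsP[c' /andP[rc' /and3P[_ /eqP ec' _]]] jkn.
have E : c = c' by apply: (reach_end_inj rc rc'); rewrite -?ec -?ec' //; lia.
by congr _.+1; apply: (IHj k c); rewrite ?rc // ?E //; lia.
Qed.

Lemma reach_flip j k d : reach x j d -> (j + k < n)%N -> reach x k (flip d) = false.
Proof.
move=> rd jkn; apply/negP; case: k jkn => [|k] jkn /=.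
  by move/eqP; apply: reach_not_back rd _; lia.
case/existsP=> c /andP[rc /and3P[c0 /eqP ec dc]].
have E : d = c by apply: (reach_end_inj rd rc); rewrite -?ec //; lia.
by rewrite E eqxx in dc.
Qed.

End Turns.

(* The voltage of a dart is the indicator of its edge, so a walk that closes up
   in the lift traverses every edge an even number of times. *)
Section Lift.
Variable G : dart_graph.
Local Notation voltage := {ffun dart G -> bool}.

Definition toggle (d : dart G) (S : voltage) : voltage :=
  [ffun c => S c (+) ((c == d) || (c == flip d))].

Definition lift_flip (u : dart G * voltage) := (flip u.1, toggle u.1 u.2).
Definition lift_start (u : dart G * voltage) := omap (pair^~ u.2) (start u.1).
Definition lift_forward : pred (dart G * voltage) := fun u => forward u.1.

Lemma lift_flipK : involutive lift_flip.
Proof.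
case=> d S; congr (_, _) => /=; rewrite ?flipK //.
by apply/ffunP=> c; rewrite !ffunE flipK [(c == flip d) || _]orbC addbK.
Qed.

Lemma lift_forward_flip u : lift_forward (lift_flip u) = ~~ lift_forward u.
Proof. exact: forward_flip. Qed.

Lemma lift_start_flip_neq u : lift_start (lift_flip u) != lift_start u.
Proof.
case: u => d S; rewrite /lift_start /=.
have := start_flip_neq d.
by case: (start d) (start (flip d)) => [y|] [z|] //=; apply: contra => /eqP[->].
Qed.

Definition edge_lift :=
  DartGraph lift_flipK lift_forward_flip lift_start_flip_neq.

Lemma lift_turn (u v : dart edge_lift) : turn u v -> turn u.1 v.1.
Proof.
case: u v => d S [d' S'] /and3P[]; rewrite /= /lift_start /=.
rewrite /turn /lift_flip; case: (start d') => //= z _.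
case: (start (flip d)) => //= y /eqP[-> ->]; rewrite eqxx.
by apply: contra => /eqP->.
Qed.

Lemma lift_path (u : dart edge_lift) s :
  path (@turn edge_lift) u s -> path (@turn G) u.1 (map fst s).
Proof.
by elim: s u => //= v s IHs u /andP[/lift_turn -> /IHs].
Qed.

Lemma start_lift_None (u : dart edge_lift) : (start u == None) = (start u.1 == None).
Proof. by rewrite /= /lift_start; case: (start u.1). Qed.

Lemma lift_toggle_once d (u : dart edge_lift) s : path (@turn edge_lift) u s ->
  ~~ has (fun v => (d == v.1) || (d == flip v.1)) s ->
  (flip (last u s)).2 d = u.2 d (+) ((d == u.1) || (d == flip u.1)).
Proof.
elim: s u => [|v s IHs] u /=; first by rewrite ffunE.
case/andP=> uv vs; rewrite negb_or => /andP[/negPf nv ns].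
rewrite IHs // nv addbF; case/and3P: uv; rewrite /= /lift_start /=.
case: (start v.1) => //= z _; case: (start _) => //= y /eqP[_ ->] _.
by rewrite ffunE.
Qed.

(** By parity a closed walk in the lift uses the edge of its first dart again. If it does so in the
    same direction, the part before that moment is closed in [G]; if in the opposite direction, the
    part strictly between the two traversals is. Either part is shorter by at least one dart. *)
Lemma tree_like_lift n : tree_like G n -> tree_like edge_lift n.+1.
Proof.
move=> tree u s us szn u0; apply/eqP=> closed.
have pus := lift_path us.
have {}szn : (size (map fst s) < n.+1)%N by rewrite size_map.
have u10 : start u.1 != None by rewrite -start_lift_None.
case: (boolP (has (fun v : dart edge_lift => (u.1 == v.1) || (u.1 == flip v.1)) s));
  last first.
  move=> /(lift_toggle_once us); rewrite eqxx addbT /=.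
  move: closed u0; rewrite /= /lift_start /=.
  case: (start u.1) => //= z; case: (start _) => //= y [_ ->] _.
  by case: (u.2 _).
rewrite -(has_map fst (fun c => (u.1 == c) || (u.1 == flip c))) => /hasP[c].
move=> c_s d_c; case/splitPr: c_s pus szn => s1 s2; rewrite size_cat /= => + szn.
rewrite cat_path /= => /and3P[ps1 t1c _]; case/orP: d_c => /eqP dc.
  have := tree _ _ ps1 _ u10; case/and3P: t1c => _ /eqP <- _.
  by rewrite dc eqxx => E; have: false by apply: E; lia.
case: s1 ps1 t1c szn => [|y s1] /=; first by rewrite dc /turn flipK !eqxx !andbF.
case/andP=> /and3P[y0 /eqP y_end _] ps1 /and3P[_ /eqP ec _] szn.
have := tree _ _ ps1 _ y0; rewrite -ec y_end dc flipK eqxx => E.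
by have: false by apply: E; lia.
Qed.
End Lift.

(** * The hybrid path and its lifts *)

(* Number of neighbours of degree 4 ([b = true]) or 3 ([b = false]) of a vertex
   of degree 4 ([q = true]) or 3 ([q = false]). *)
Definition out_degree (q b : bool) : nat :=
  if q then (if b then 0 else 4) else (if b then 2 else 1).

(* [quad] and [inner_quad] single out the vertices of degree 4.  Since [rank]
   decreases along [steer], every dart can be continued to the root without
   backtracking. *)
Record labelling (l X : nat) (G : dart_graph) := Labelling {
  quad : pred (dart G);
  inner_quad : pred (inner G);
  rank : dart G -> nat;
  quad_start : forall d z, start d = Some z -> quad d = inner_quad z;
  card_out : forall z b,
    #|[pred d | (start d == Some z) && (quad (flip d) == b)]|
      = out_degree (inner_quad z) b;
  steer : forall d, start (flip d) != None ->
    exists2 d', turn d d' & (rank d' < rank d)%N;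
  rank_le : forall d, (rank d <= 5 * l + 4)%N;
  card_inner : #|inner G| = (3 * l * X)%N;
  card_inner_quad : #|[pred z | inner_quad z]| = (l * X)%N;
  card_forward : #|[pred d : dart G | forward d]| = ((5 * l + 1) * X)%N
}.

Section LiftLabelling.
Variables (l X : nat) (G : dart_graph) (lab : labelling l X G).
Local Notation voltage := {ffun dart G -> bool}.

Definition lift_quad : pred (dart (edge_lift G)) := fun u => quad lab u.1.
Definition lift_inner_quad : pred (inner (edge_lift G)) := fun y => inner_quad lab y.1.
Definition lift_rank (u : dart (edge_lift G)) := rank lab u.1.

Lemma lift_quad_start u y : start u = Some y -> lift_quad u = lift_inner_quad y.
Proof.
case: u => d S; rewrite /= /lift_start /=.
by case dz: (start d) => [z|] // [<-]; apply: quad_start.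
Qed.

Lemma lift_card_out y b :
  #|[pred u | (start u == Some y) && (lift_quad (flip u) == b)]|
    = out_degree (lift_inner_quad y) b.
Proof.
case: y => z S; rewrite -(card_out lab).
rewrite -(fintype.card_image (f := fun d => (d, S) : dart (edge_lift G))); last by move=> d c [].
apply: eq_card => -[d T]; rewrite !inE /= /lift_start /=.
apply/andP/fintype.imageP => [[dz db] | [c /andP[/eqP cz cb] [-> ->]]]; last first.
  by rewrite cz eqxx.
case dy: (start d) dz => [y|] //= /eqP[yz <-].
by exists d; rewrite // inE dy yz eqxx.
Qed.

Lemma lift_steer u : start (flip u) != None ->
  exists2 v, turn u v & (lift_rank v < lift_rank u)%N.
Proof.
case: u => d S; rewrite start_lift_None /= => /(steer lab)[d' dd' rd'].
exists (d', toggle d S) => //; case/and3P: dd' => d0 /eqP dd' nd.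
rewrite /turn /= /lift_start /= dd' eqxx -dd' /=.
by case: (start d') d0 => //= z _; apply: contra nd => /eqP[->].
Qed.

Definition lift_labelling :
  labelling l (X * #|{: voltage}|) (edge_lift G).
Proof.
exists lift_quad lift_inner_quad lift_rank.
- exact: lift_quad_start.
- exact: lift_card_out.
- exact: lift_steer.
- by move=> u; apply: rank_le.
- by rewrite card_prod (card_inner lab) mulnA.
- rewrite mulnA -(card_inner_quad lab) -cardX; apply: eq_card => -[z S].
  by rewrite !inE andbT.
- rewrite mulnA -(card_forward lab) -cardX; apply: eq_card => -[z S].
  by rewrite !inE andbT.
Defined.

End LiftLabelling.

(* A path of [l.+1] cells, each with a vertex of kind 0, of degree 4, and
   vertices of kinds 1 and 2, of degree 3.  Ports 0-3 leave the vertex of kind 0,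
   ports 4-6 the one of kind 1, ports 7-9 the one of kind 2.  The edges inside a
   cell join ports 0-4, 1-7, 2-8 and 5-9; port 3 is joined to port 6 of the next
   cell.  The darts [inr true] and [inr false] leave the root for the last and
   the first cell. *)
Section Base.
Variable l : nat.

Notation "''port_' k" := (@Ordinal 10 k isT) (at level 8, k at level 2).
Notation "''kind_' k" := (@Ordinal 3 k isT) (at level 8, k at level 2).

Definition port_flip (p : 'I_10) : 'I_10 := match val p with
  0 => 'port_4 | 1 => 'port_7 | 2 => 'port_8 | 4 => 'port_0 | 5 => 'port_9
| 7 => 'port_1 | 8 => 'port_2 | 9 => 'port_5 | _ => 'port_0 end%N.

Definition port_kind (p : 'I_10) : 'I_3 := match val p with
  0 | 1 | 2 | 3 => 'kind_0 | 4 | 5 | 6 => 'kind_1 | _ => 'kind_2 end%N.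

Definition base_inner : finType := ('I_l.+1 * 'I_3)%type.
Definition base_dart : finType := ('I_l.+1 * 'I_10 + bool)%type.

Definition base_flip (d : base_dart) : base_dart := match d with
| inl (i, p) =>
    if val p == 3 then if i == ord_max then inr true else inl (inord i.+1, 'port_6)
    else if val p == 6 then if i == ord0 then inr false else inl (inord i.-1, 'port_3)
    else inl (i, port_flip p)
| inr true => inl (ord_max, 'port_3)
| inr false => inl (ord0, 'port_6)
end.

Definition base_start (d : base_dart) : option base_inner :=
  if d is inl (i, p) then Some (i, port_kind p) else None.

Definition base_forward : pred base_dart := fun d => match d with
| inl (i, p) => val p \in [:: 0; 1; 2; 5; 6]%N
| inr b => b
end.

(** At both ends of the path the root poses as the missing cell: as a vertex of degree 3 beyond port
    3 of the last cell, of degree 4 beyond port 6 of the first. *)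
Definition base_quad : pred base_dart := fun d => match d with
| inl (i, p) => (p < 4)%N
| inr b => ~~ b
end.

(** Steering leads down the cells through ports 0 and 6 and out at the first cell. A walk going up
    through port 3 turns round in the next cell by ports 4, 1, 9 and 6, unless it has met the
    root. *)
Definition base_rank (d : base_dart) : nat := match d with
| inl (i, p) => 5 * i + nth 0 [:: 1; 2; 2; 9; 3; 3; 0; 2; 2; 1] p
| inr b => if b then 5 * l.+1 else 4
end%N.

Local Ltac ports := case=> [[|[|[|[|[|[|[|[|[|[|//]]]]]]]]]] ?].

Lemma inord_max_neq (i : 'I_l.+1) : i != ord_max -> (inord i.+1 : 'I_l.+1) = i.+1 :> nat.
Proof.
rewrite -val_eqE /= => il; rewrite inordK //.
by rewrite ltnS ltn_neqAle il -ltnS ltn_ord.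
Qed.

Lemma inord_pred (i : 'I_l.+1) : (inord i.-1 : 'I_l.+1) = i.-1 :> nat.
Proof. by rewrite inordK // (leq_ltn_trans (leq_pred _)). Qed.

Lemma base_flipK : involutive base_flip.
Proof.
case=> [[i p]|[]] /=; rewrite ?eqxx //; move: p.
ports => /=; try by congr (inl (_, _)); apply: val_inj.
- case: eqVneq => [->|im] /=; first by congr (inl (_, _)); apply: val_inj.
  have -> : (inord i.+1 == ord0 :> 'I_l.+1) = false.
    by rewrite -val_eqE /= (inord_max_neq im).
  by congr (inl (_, _)); apply: val_inj; rewrite //= (inord_max_neq im) inord_val.
- case: eqVneq => [->|i0] /=; first by congr (inl (_, _)); apply: val_inj.
  have ip : (0 < i)%N by rewrite lt0n.
  have -> : (inord i.-1 == ord_max :> 'I_l.+1) = false.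
    by rewrite -val_eqE /= inord_pred ltn_eqF //; have := ltn_ord i; lia.
  by congr (inl (_, _)); apply: val_inj => //=; rewrite inord_pred prednK // inord_val.
Qed.

Lemma base_forward_flip d : base_forward (base_flip d) = ~~ base_forward d.
Proof. by case: d => [[i p]|[]] //; move: p; ports => //=; case: eqP. Qed.

Lemma base_start_flip_neq d : base_start (base_flip d) != base_start d.
Proof.
case: d => [[i p]|[]] //; move: p; ports => //=.
1-3, 5-6, 8-10: by apply/eqP.
all: by case: (eqVneq i) => // _; apply/eqP.
Qed.

Definition base := DartGraph base_flipK base_forward_flip base_start_flip_neq.

Lemma base_quad_flip (i : 'I_l.+1) (p : 'I_10) :
  base_quad (base_flip (inl (i, p))) = (val p \in [:: 4; 6; 7; 8]%N).
Proof. by move: p; ports => //=; case: eqP. Qed.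

Lemma card_base_dart (P : pred base_dart) :
  #|[pred d | P d]| =
  (\sum_i \sum_p P (inl (i, p)) + (P (inr true) + P (inr false)))%N.
Proof.
rewrite -sum1_card big_mkcond big_sumType /= big_bool pair_bigA /=.
by congr (_ + (_ + _))%N; first (apply: eq_bigr => -[i p] _); rewrite inE; case: (P _).
Qed.

Lemma base_card_out (z : inner base) b :
  #|[pred d : dart base | (start d == Some z) && (base_quad (flip d) == b)]|
    = out_degree (z.2 == ord0) b.
Proof.
rewrite card_base_dart /= !addn0 (bigD1 z.1) //= [X in (_ + X)%N]big1 ?addn0; last first.
  move=> i iz; rewrite big1 // => p _.
  by case: eqP => // -[E]; rewrite -E eqxx in iz.
under eq_bigr do rewrite base_quad_flip.
case: z => i; case=> [[|[|[|//]]] ?]; case: b;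
  by rewrite !big_ord_recl big_ord0 /= !(inj_eq Some_inj) !xpair_eqE !eqxx.
Qed.

Local Ltac turn_into d :=
  exists d; [by rewrite /= ?eqxx //=; apply/eqP | rewrite /=; try lia].

Lemma base_steer (d : dart base) : start (flip d) != None ->
  exists2 d', turn d d' & (base_rank d' < base_rank d)%N.
Proof.
rewrite /turn; case: d => [[i p]|[] _]; last 2 first.
- turn_into (inl (ord_max, 'port_0) : base_dart).
- turn_into (inl (ord0, 'port_4) : base_dart).
move: p; ports => /= d0.
- turn_into (inl (i, 'port_6) : base_dart).
- turn_into (inl (i, 'port_9) : base_dart).
- turn_into (inl (i, 'port_9) : base_dart).
- case: (eqVneq i) d0 => //= im _; turn_into (inl (inord i.+1, 'port_4) : base_dart).
  by rewrite inord_max_neq //; lia.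
- turn_into (inl (i, 'port_1) : base_dart).
- turn_into (inl (i, 'port_7) : base_dart).
- case: (eqVneq i) d0 => //= i0 _; have ip : (0 < i)%N by rewrite lt0n.
  by turn_into (inl (inord i.-1, 'port_0) : base_dart); rewrite inord_pred; lia.
- turn_into (inl (i, 'port_0) : base_dart).
- turn_into (inl (i, 'port_0) : base_dart).
- turn_into (inl (i, 'port_6) : base_dart).
Qed.

Definition base_labelling : labelling l.+1 1 base.
Proof.
exists base_quad (fun z : inner base => z.2 == ord0) base_rank.
- by case=> [[i p]|[]] z // [<-]; move: p; ports.
- exact: base_card_out.
- exact: base_steer.
- case=> [[i p]|[]] /=; try lia.
  by have := ltn_ord i; move: p; ports => /=; lia.
- by rewrite card_prod !card_ord; lia.
- rewrite (@eq_card _ _ [predX 'I_l.+1 & pred1 (ord0 : 'I_3)]); last first.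
    by move=> z; rewrite !inE.
  by rewrite cardX card1 card_ord !muln1.
- rewrite card_base_dart /=.
  under eq_bigr do rewrite !big_ord_recl big_ord0 /=.
  by rewrite sum_nat_const card_ord; lia.
Defined.
End Base.

(** * Spreading a unit current *)

Lemma sqr_sum_disjoint (R : comPzRingType) (I : finType) (P : pred I) (c : I -> R) :
  (forall i j, P i -> P j -> i != j -> c i * c j = 0) ->
  (\sum_(i | P i) c i) ^+ 2 = \sum_(i | P i) c i ^+ 2.
Proof.
move=> c0; rewrite expr2 big_distrlr /=; apply: eq_bigr => i Pi.
rewrite (bigD1 i) //= big1 ?addr0 ?expr2 // => j /andP[Pj ji].
by apply: c0; rewrite // eq_sym.
Qed.

Section Spreading.
Variables (R : realFieldType) (G : dart_graph) (x : inner G).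
Variables (split0 : dart G -> R) (split : nat -> dart G -> dart G -> R).

(** [split k d d'] is the fraction of the current arriving along [d] after [k] turns that continues
    along [d']. *)
Fixpoint level k : dart G -> R :=
  if k is k'.+1 then
    fun d' => \sum_(d | turn d d') level k' d * split k' d d'
  else fun d => if start d == Some x then split0 d else 0.

Definition spread m d := \sum_(k < m) (level k d - level k (flip d)).

Lemma level_reach k d : level k d != 0 -> reach x k d.
Proof.
elim: k d => [|k IHk] d /=; first by case: ifP; rewrite ?eqxx.
apply: contraR => nex; rewrite big1 // => c cd.
have [-> | /IHk rc] := eqVneq (level k c) 0; first by rewrite mul0r.
by case/negP: nex; apply/existsP; exists c; rewrite rc.
Qed.

Lemma spread_flip m d : spread m (flip d) = - spread m d.
Proof.
by rewrite /spread -sumrN; apply: eq_bigr => k _; rewrite flipK opprB.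
Qed.

(** What leaves [z] at level [k.+1] is what arrived there at level [k], so the sum over the levels
    telescopes. Short cycles do no harm here. *)
Lemma spread_divergence m z :
  \sum_(d | start d == Some x) split0 d = 1 ->
  (forall k d, start (flip d) != None -> \sum_(d' | turn d d') split k d d' = 1) ->
  (forall d, level m d = 0) ->
  \sum_(d | start d == Some z) spread m d = (z == x)%:R.
Proof.
move=> sum0 sum1 levelm.
pose out k := \sum_(d | start d == Some z) level k d.
have out0 : out 0 = (z == x)%:R.
  rewrite /out /=; have [-> | zx] := eqVneq z x.
    by rewrite -sum0; apply: eq_bigr => d ->.
  by rewrite big1 // => d /eqP->; rewrite (inj_eq Some_inj) (negPf zx).
have outS k : out k.+1 = \sum_(d | start d == Some z) level k (flip d).
  rewrite /out /= (exchange_big_dep predT) //= [RHS](reindex_inj (@flip_inj G)) /=.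
  rewrite [RHS]big_mkcond; apply: eq_bigr => d _.
  rewrite flipK; case: eqP => [dz | dz].
    rewrite -mulr_sumr (eq_bigl (turn d)) ?sum1 ?mulr1 ?dz // => d'.
    rewrite /turn dz; case: (start d' =P Some z) => [->|] //=.
    by rewrite andbF.
  rewrite big1 // => d' /andP[/eqP d'z /and3P[_ /eqP dd' _]].
  by case: dz; rewrite -dd'.
rewrite exchange_big /= (eq_bigr (fun k : 'I_m => out k - out k.+1)); last first.
  by move=> k _; rewrite outS -sumrB.
rewrite -(big_mkord xpredT (fun k => out k - out k.+1)).
under eq_bigr do rewrite -opprB.
rewrite sumrN telescope_sumr // opprB out0.
by rewrite [out m]big1 ?subr0 // => d _; apply: levelm.
Qed.

Variable n : nat.
Hypothesis tree : tree_like G n.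

Lemma level_mul0 j k d : (j + k < n)%N -> j != k -> level j d * level k d = 0.
Proof.
move=> jkn jk; have [-> | /level_reach rj] := eqVneq (level j d) 0; first exact: mul0r.
have [-> | /level_reach rk] := eqVneq (level k d) 0; first exact: mulr0.
by rewrite (reach_level_inj tree rj rk jkn) eqxx in jk.
Qed.

Lemma level_flip_mul0 j k d : (j + k < n)%N -> level j d * level k (flip d) = 0.
Proof.
move=> jkn; have [-> | /level_reach rj] := eqVneq (level j d) 0; first exact: mul0r.
have [-> | /level_reach] := eqVneq (level k (flip d)) 0; first exact: mulr0.
by rewrite (reach_flip tree rj jkn).
Qed.

(** Different levels, and opposite darts, have disjoint supports, so all cross terms vanish. The
    factor 2 appears because both darts of each edge are summed. *)
Lemma spread_energy m : (2 * m <= n)%N ->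
  \sum_d spread m d ^+ 2 = 2 * \sum_(k < m) \sum_d level k d ^+ 2.
Proof.
move=> mn; rewrite mulr_natl mulr2n [X in _ = X + _]exchange_big [X in _ = _ + X]exchange_big.
rewrite [X in _ = _ + X](reindex_inj (@flip_inj G)) /= -big_split /=.
apply: eq_bigr => d _; rewrite sqr_sum_disjoint => [|j k _ _ jk].
  rewrite -big_split /=; apply: eq_bigr => k _; rewrite sqrrB.
  by rewrite level_flip_mul0 ?mul0rn ?subr0 //; have := ltn_ord k; lia.
have [jm km] := (ltn_ord j, ltn_ord k).
rewrite mulrBl !mulrBr !level_mul0 ?level_flip_mul0 //; try lia.
by rewrite mulrC level_flip_mul0 ?subrr //; lia.
Qed.

(** By [reach_end_inj] at most one dart feeds [d'], so the square of the sum is the sum of the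
    squares. *)
Lemma level_step k (w : dart G -> R) : (2 * k + 1 < n)%N ->
  \sum_d level k.+1 d ^+ 2 * w d
    = \sum_d level k d ^+ 2 * \sum_(d' | turn d d') split k d d' ^+ 2 * w d'.
Proof.
move=> kn; transitivity
    (\sum_d' \sum_(d | turn d d') (level k d * split k d d') ^+ 2 * w d').
  apply: eq_bigr => d' _; rewrite -mulr_suml -sqr_sum_disjoint // => d c.
  move=> /and3P[d0 /eqP ed _] /and3P[_ /eqP ec _] dc.
  rewrite mulrACA; have [-> | /level_reach rd] := eqVneq (level k d) 0; first by rewrite !mul0r.
  have [-> | /level_reach rc] := eqVneq (level k c) 0; first by rewrite mulr0 mul0r.
  suff E : d = c by rewrite E eqxx in dc.
  by apply: (reach_end_inj tree rd rc); rewrite -?ed -?ec //; lia.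
rewrite (exchange_big_dep predT) //=; apply: eq_bigr => d _.
by rewrite mulr_sumr; apply: eq_bigr => d' _; rewrite exprMn mulrA.
Qed.

End Spreading.

(** * Energy of the tree-like flow *)

Section SplitRatios.
Variable R : realFieldType.

(* The optimal ratios involve the golden ratio phi; these are rational
   approximations. *)
Definition split0_ratio (q b : bool) : R :=
  if q then 1 / 4 else if b then 9 / 26 else 8 / 26.

Definition split_ratio (p q b : bool) : R :=
  if q then 1 / 3 else if p then (if b then 9 / 17 else 8 / 17) else 1 / 2.

(* Bounds for the energy of a unit current that enters the infinite tree through
   an edge from a vertex of type [p] to one of type [q].  The exact values
   3 / phi, phi and 1 + phi / 2 are replaced by quotients of Fibonacci numbers;
   the pair [p = q = true] does not occur. *)
Definition branch_energy (p q : bool) : R :=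
  if p then 699 / 377 else if q then 610 / 377 else 682 / 377.

Definition source_energy (q : bool) : R :=
  (out_degree q true)%:R * (split0_ratio q true ^+ 2 * branch_energy q true) +
  (out_degree q false)%:R * (split0_ratio q false ^+ 2 * branch_energy q false).

Lemma split0_ratio_sum q :
  (out_degree q true)%:R * split0_ratio q true +
  (out_degree q false)%:R * split0_ratio q false = 1.
Proof. by case: q; rewrite /out_degree /split0_ratio; lra. Qed.

(** The subtracted term stands for the edge back to the vertex of type [p] from which the current
    came. *)
Lemma split_ratio_sum p q :
  (out_degree q true)%:R * split_ratio p q true +
  (out_degree q false)%:R * split_ratio p q false - split_ratio p q p = 1.
Proof. by case: p; case: q; rewrite /out_degree /split_ratio; lra. Qed.

(** The table is a supersolution of the recursion for tree energies: one edge, then the branches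
    weighted by squared ratios. *)
Lemma branch_energy_step p q :
  1 + ((out_degree q true)%:R * (split_ratio p q true ^+ 2 * branch_energy q true) +
  (out_degree q false)%:R * (split_ratio p q false ^+ 2 * branch_energy q false)
  - split_ratio p q p ^+ 2 * branch_energy q p) <= branch_energy p q.
Proof.
by case: p; case: q; rewrite /out_degree /split_ratio /branch_energy !expr2; lra.
Qed.

Lemma branch_energy_bounds p q : 1 <= branch_energy p q <= 2.
Proof. by case: p; case: q; rewrite /branch_energy; lra. Qed.

Lemma source_energy_le1 q : source_energy q <= 1.
Proof.
by case: q; rewrite /source_energy /out_degree /split0_ratio /branch_energy !expr2; lra.
Qed.

(** A cell has one vertex of degree 4 and two of degree 3. The saving [539 / 380] slightly exceeds
    [1773 / 1250], four times 0.3546; [savings_bound] spends the margin. *)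
Lemma source_energy_mean : source_energy true + 2 * source_energy false <= 3 - 539 / 380.
Proof.
by rewrite /source_energy /out_degree /split0_ratio /branch_energy !expr2; lra.
Qed.

End SplitRatios.

Section TreeFlow.
Variables (R : realFieldType) (l X : nat) (G : dart_graph) (lab : labelling l X G).
Variable depth : nat.
Let quad := quad lab.
Let m := (depth + (5 * l + 5))%N.

(* The successor of [d] on its way to the root. *)
Definition steered (d : dart G) : dart G :=
  odflt d [pick d' | turn d d' & (rank lab d' < rank lab d)%N].

Definition tree_split k (d d' : dart G) : R :=
  if (k < depth)%N then split_ratio R (quad d) (quad (flip d)) (quad (flip d'))
  else (d' == steered d)%:R.

Lemma steered_turn d : start (flip d) != None ->
  turn d (steered d) /\ (rank lab (steered d) < rank lab d)%N.
Proof.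
case/(steer lab) => d' dd' rd'; rewrite /steered; case: pickP => [c /andP[] //|].
by move/(_ d'); rewrite dd' rd'.
Qed.

Lemma out_sum z (f : bool -> R) :
  \sum_(d | start d == Some z) f (quad (flip d)) =
  (out_degree (inner_quad lab z) true)%:R * f true +
  (out_degree (inner_quad lab z) false)%:R * f false.
Proof.
rewrite (bigID (fun d => quad (flip d))) /=.
rewrite -!(card_out lab) -!sum1_card !natr_sum !mulr_suml.
congr (_ + _); apply: eq_big => d; rewrite ?inE; rewrite -/quad;
  by case: (quad _); rewrite ?andbF ?mul1r ?eqxx.
Qed.

Lemma turn_sum d (f : bool -> R) : start (flip d) != None ->
  \sum_(d' | turn d d') f (quad (flip d')) =
  (out_degree (quad (flip d)) true)%:R * f true +
  (out_degree (quad (flip d)) false)%:R * f false - f (quad d).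
Proof.
case dz : (start (flip d)) => [z|] // _.
have -> : quad (flip d) = inner_quad lab z by apply: quad_start.
rewrite -out_sum.
rewrite [X in _ = X - _](bigD1 (flip d)) ?dz //= flipK [RHS]addrAC subrr add0r.
apply: eq_bigl => d'; rewrite /turn dz.
by case: (start d' =P _) => [->|] //=; rewrite andbF.
Qed.

Lemma turn_None d (F : dart G -> R) : start (flip d) = None ->
  \sum_(d' | turn d d') F d' = 0.
Proof.
move=> d0; apply: big_pred0 => d'; rewrite /turn d0.
by case: (start d').
Qed.

Lemma quad_turn d d' : turn d d' -> quad d' = quad (flip d).
Proof.
case/and3P; case dz : (start d') => [z|] // _ /eqP dz' _.
by rewrite /quad (quad_start lab dz) (quad_start lab (esym dz')).
Qed.

Lemma tree_split_sum k d : start (flip d) != None ->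
  \sum_(d' | turn d d') tree_split k d d' = 1.
Proof.
move=> d0; rewrite /tree_split; case: (ltnP k depth) => _.
  by rewrite (@turn_sum d (split_ratio R (quad d) (quad (flip d)))) // split_ratio_sum.
have [ds _] := steered_turn d0.
by rewrite (bigD1 (steered d)) //= eqxx big1 ?addr0 // => d' /andP[_ /negPf ->].
Qed.

Variable x : inner G.

Definition tree_split0 (d : dart G) : R :=
  split0_ratio R (inner_quad lab x) (quad (flip d)).

Let lev := level x tree_split0 tree_split.

(** Each steered step lowers the rank, which is at most [5 * l + 4] at the outset. Hence level [m]
    vanishes: by then all current has reached the root. *)
Lemma tree_level_rank i d : lev (depth + i) d != 0 -> (rank lab d + i <= 5 * l + 4)%N.
Proof.
elim: i d => [|i IHi] d; first by rewrite !addn0 => _; apply: rank_le.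
rewrite addnS /lev /= -/lev; apply: contraR; rewrite -ltnNge => ri.
apply/eqP; rewrite big1 // => c cd.
rewrite /tree_split ifN -?leqNgt ?leq_addr //.
have [-> | /IHi rc] := eqVneq (lev (depth + i) c) 0; first by rewrite mul0r.
have [E | _] := eqVneq d (steered c); last by rewrite mulr0.
have := steered_turn (d := c); rewrite -E; case/and3P: cd => d0 /eqP <- _.
by case/(_ d0) => _; move: rc ri; lia.
Qed.

Definition tree_flow := spread x tree_split0 tree_split m.

Lemma tree_flow_divergence z :
  \sum_(d | start d == Some z) tree_flow d = (z == x)%:R.
Proof.
apply: spread_divergence.
- by rewrite (out_sum x (split0_ratio R _)) split0_ratio_sum.
- exact: tree_split_sum.
move=> d; apply/eqP; apply: contraT => /tree_level_rank; lia.
Qed.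

Hypothesis tree : tree_like G (2 * m + 2).

Let Q k := \sum_d lev k d ^+ 2.
(** A bound for the energy that the current of level [k] and its continuation would dissipate in the
    infinite tree. *)
Let Phi k := \sum_d lev k d ^+ 2 * branch_energy R (quad d) (quad (flip d)).

Lemma tree_energy0 : Phi 0 = source_energy R (inner_quad lab x).
Proof.
rewrite /Phi /source_energy -(out_sum x (fun b => split0_ratio R _ b ^+ 2 * branch_energy R _ b)).
rewrite [RHS]big_mkcond; apply: eq_bigr => d _; rewrite /lev /=.
case: eqP => [dx|]; last by rewrite expr0n mul0r.
by rewrite /quad (quad_start lab dx).
Qed.

Lemma level_energy_le k : Q k <= Phi k <= 2 * Q k.
Proof.
rewrite mulr_sumr; apply/andP; split; apply: ler_sum => d _;
  have /andP[w1 w2] := branch_energy_bounds R (quad d) (quad (flip d));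
  have := sqr_ge0 (lev k d); nra.
Qed.

Lemma tree_energy_step k : (k < depth)%N -> Phi k.+1 + Q k <= Phi k.
Proof.
move=> kd; rewrite /Phi /lev (level_step _ _ _ tree); last by move: kd; rewrite /m; lia.
rewrite -/lev -big_split /=; apply: ler_sum => d _.
rewrite -[X in _ + X]mulr1 -mulrDr ler_wpM2l ?sqr_ge0 //.
(* Current that has reached the root stops there, and a weight of at least 1 covers its own
   energy. *)
have [d0 | d0] := eqVneq (start (flip d)) None.
  by rewrite turn_None // add0r; case/andP: (branch_energy_bounds R (quad d) (quad (flip d))).
apply: le_trans (branch_energy_step R (quad d) (quad (flip d))).
rewrite addrC lerD2l -(turn_sum (fun b => _ ^+ 2 * branch_energy R _ b)) //.
by apply: ler_sum => d' dd'; rewrite /tree_split kd (quad_turn dd').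
Qed.

(** Each step removes [Q k], which is at least half of [Phi k]. *)
Lemma tree_energy_decay k : (k <= depth)%N -> Phi k <= 2^-1 ^+ k.
Proof.
elim: k => [|k IHk] kd; first by rewrite tree_energy0 source_energy_le1.
have := tree_energy_step kd; have := level_energy_le k; have := IHk (ltnW kd).
rewrite exprS; lra.
Qed.

(** A steered piece moves on undivided, or stops at the root; distinct pieces never merge at these
    levels, by [level_step]. *)
Lemma tail_energy_step k : (depth <= k < m)%N -> Q k.+1 <= Q k.
Proof.
case/andP=> dk km; rewrite /Q /lev.
under eq_bigr do rewrite -[_ ^+ 2]mulr1.
rewrite (level_step _ _ _ tree); last by move: km; rewrite /m; lia.
rewrite -/lev; apply: ler_sum => d _; rewrite ler_piMr ?sqr_ge0 //.
have [d0 | d0] := eqVneq (start (flip d)) None; first by rewrite turn_None ?ler01.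
rewrite -[leRHS](tree_split_sum k d0); apply: ler_sum => d' _.
by rewrite mulr1 /tree_split ltnNge dk /=; case: (_ == _); rewrite ?expr1n ?expr0n.
Qed.

Lemma tail_energy i : (i < 5 * l + 5)%N -> Q (depth + i) <= 2^-1 ^+ depth.
Proof.
elim: i => [|i IHi] il.
  have /andP[+ _] := level_energy_le depth; have := tree_energy_decay (leqnn depth).
  rewrite addn0; lra.
apply: le_trans (IHi (ltnW il)); rewrite addnS; apply: tail_energy_step.
by rewrite leq_addr /m ltn_add2l ltnW.
Qed.

Lemma tree_flow_energy : \sum_d tree_flow d ^+ 2 <=
  2 * (source_energy R (inner_quad lab x) + (5 * l + 5)%:R * 2^-1 ^+ depth).
Proof.
rewrite (spread_energy _ _ _ tree) ?ler_pM2l //; last by rewrite /m; lia.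
rewrite big_split_ord /=; apply: lerD; last first.
  rewrite mulr_natl -[X in _ *+ X]card_ord -sumr_const.
  by apply: ler_sum => i _; apply: tail_energy.
rewrite -tree_energy0.
(* Telescoping [tree_energy_step] bounds the energy of the first [depth] levels by the initial
   potential. *)
suff E k : (k <= depth)%N -> \sum_(i < k) Q i + Phi k <= Phi 0.
  have /andP[+ _] := level_energy_le depth.
  have : 0 <= Q depth by apply: sumr_ge0 => d _; apply: sqr_ge0.
  have := E _ (leqnn depth); rewrite /Q; lra.
elim: k => [|k IHk] kd; first by rewrite big_ord0 add0r.
rewrite big_ord_recr /=; have := tree_energy_step kd; have := IHk (ltnW kd); lra.
Qed.

End TreeFlow.

(** * Gluing graphs at the root *)

Section Achievable.
Variable R : realFieldType.

Definition root_flows (G : dart_graph) (theta : inner G -> dart G -> R) :=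
  (forall x d, theta x (flip d) = - theta x d) /\
  (forall x z, \sum_(d | start d == Some z) theta x d = (z == x)%:R).

Definition achievable (n m : nat) (S : R) :=
  exists (G : dart_graph) (theta : inner G -> dart G -> R),
  [/\ #|inner G| = n, #|[pred d : dart G | forward d]| = m, root_flows theta
    & \sum_x \sum_(d | forward d) theta x d ^+ 2 <= S].

Lemma sum_forward (G : dart_graph) (f : dart G -> R) :
  \sum_(d | forward d) f (flip d) = \sum_(d | ~~ forward d) f d.
Proof.
rewrite [RHS](reindex_inj (@flip_inj G)) /=.
by apply: eq_bigl => d; rewrite forward_flip negbK.
Qed.

Section Wedge.
Variables G1 G2 : dart_graph.

Definition wedge_flip (d : dart G1 + dart G2) :=
  match d with inl d => inl (flip d) | inr d => inr (flip d) end.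
Definition wedge_start (d : dart G1 + dart G2) : option (inner G1 + inner G2) :=
  match d with inl d => omap inl (start d) | inr d => omap inr (start d) end.
Definition wedge_forward : pred (dart G1 + dart G2) := fun d =>
  match d with inl d => forward d | inr d => forward d end.

Lemma wedge_flipK : involutive wedge_flip.
Proof. by case=> d /=; rewrite flipK. Qed.

Lemma wedge_forward_flip d : wedge_forward (wedge_flip d) = ~~ wedge_forward d.
Proof. by case: d => d /=; rewrite forward_flip. Qed.

Lemma wedge_start_flip_neq d : wedge_start (wedge_flip d) != wedge_start d.
Proof.
case: d => d /=; have := start_flip_neq d;
  by case: (start d) (start (flip d)) => [y|] [z|] //=; apply: contra => /eqP[->].
Qed.

Definition wedge := DartGraph wedge_flipK wedge_forward_flip wedge_start_flip_neq.

Lemma wedge_start_inl d z : (start (inl d : dart wedge) == Some (inl z)) = (start d == Some z).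
Proof. by rewrite /=; case: (start d). Qed.

Lemma wedge_start_inr d z : (start (inr d : dart wedge) == Some (inr z)) = (start d == Some z).
Proof. by rewrite /=; case: (start d). Qed.

Lemma wedge_start_inlr d z : (start (inl d : dart wedge) == Some (inr z)) = false.
Proof. by rewrite /=; case: (start d). Qed.

Lemma wedge_start_inrl d z : (start (inr d : dart wedge) == Some (inl z)) = false.
Proof. by rewrite /=; case: (start d). Qed.

Variables (theta1 : inner G1 -> dart G1 -> R) (theta2 : inner G2 -> dart G2 -> R).

Definition wedge_flow (x : inner wedge) (d : dart wedge) : R :=
  match x, d with
  | inl x, inl d => theta1 x d
  | inr x, inr d => theta2 x d
  | _, _ => 0
  end.

Lemma wedge_root_flows : root_flows theta1 -> root_flows theta2 ->
  root_flows wedge_flow.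
Proof.
move=> [f1 k1] [f2 k2]; split; first by move=> [x|x] [d|d] //=; rewrite oppr0.
move=> x z; rewrite big_sumType /=.
case: z => z; [under eq_bigl do rewrite wedge_start_inl |
               under eq_bigl do rewrite wedge_start_inlr];
 [under [X in _ + X]eq_bigl do rewrite wedge_start_inrl |
  under [X in _ + X]eq_bigl do rewrite wedge_start_inr];
 rewrite big_pred0_eq ?addr0 ?add0r; case: x => x /=; rewrite ?k1 ?k2 ?big1 //.
Qed.

Lemma wedge_energy : \sum_x \sum_(d | forward d) wedge_flow x d ^+ 2 =
  \sum_x \sum_(d | forward d) theta1 x d ^+ 2 +
  \sum_x \sum_(d | forward d) theta2 x d ^+ 2.
Proof.
rewrite big_sumType /=; congr (_ + _); apply: eq_bigr => x _; rewrite big_sumType /=.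
  by rewrite [X in _ + X]big1 ?addr0 // => d _; rewrite expr0n.
by rewrite [X in X + _]big1 ?add0r // => d _; rewrite expr0n.
Qed.

Lemma wedge_card_forward : #|[pred d : dart wedge | forward d]| =
  (#|[pred d : dart G1 | forward d]| + #|[pred d : dart G2 | forward d]|)%N.
Proof. by rewrite -!sum1_card big_sumType. Qed.

End Wedge.

Lemma achievableD n1 m1 S1 n2 m2 S2 : achievable n1 m1 S1 -> achievable n2 m2 S2 ->
  achievable (n1 + n2) (m1 + m2) (S1 + S2).
Proof.
move=> [G1 [t1 [<- <- f1 S1E]]] [G2 [t2 [<- <- f2 S2E]]].
exists (wedge G1 G2), (wedge_flow t1 t2); split.
- by rewrite /= card_sum.
- exact: wedge_card_forward.
- exact: wedge_root_flows.
- by rewrite wedge_energy lerD.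
Qed.

Lemma achievable0 : achievable 0 0 0.
Proof.
pose G := @DartGraph void void id (fun=> None) xpred0 (fun=> erefl)
  (fun d => match d with end) (fun d => match d with end).
exists G, (fun _ _ => 0); split.
- exact: card_void.
- by apply: fintype.eq_card0; case.
- by split=> -[].
- by rewrite big1 // => -[].
Qed.

Lemma achievableM p n m S : achievable n m S -> achievable (p * n) (p * m) (p%:R * S).
Proof.
move=> a; elim: p => [|p IHp]; first by rewrite mul0r; apply: achievable0.
by rewrite !mulSn mulrS mulrDl mul1r; apply: achievableD.
Qed.

Lemma achievable1 : achievable 1 1 1.
Proof.
have neq (d : bool) : (if ~~ d then Some tt else None) != (if d then Some tt else None).
  by case: d.
pose G := @DartGraph unit bool negb (fun d => if d then Some tt else None) id
  negbK (fun=> erefl) neq.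
exists G, (fun _ d => if d then 1 else -1); split.
- exact: card_unit.
- by rewrite (@fintype.eq_card1 _ true) // => -[].
- split; first by move=> _ [] /=; rewrite ?opprK.
  by move=> [] [] /=; rewrite big_mkcond big_bool /= addr0.
- by rewrite (big_pred1 tt) => [|[]] //; rewrite big_mkcond big_bool /= addr0 expr1n.
Qed.

(** * Graphs with a large saving per additional edge *)

Lemma labelled_tree_like l n : exists X (G : dart_graph),
  [/\ (0 < X)%N, inhabited (labelling l.+1 X G) & tree_like G n].
Proof.
elim: n => [|n [X [G [X0 [lab] tree]]]].
  (* For [n = 0] the condition [tree_like] is vacuous; each lift then gains one. *)
  by exists 1%N, (base l); split=> //; split; apply: base_labelling.
exists (X * #|{: {ffun dart G -> bool}}|)%N, (edge_lift G); split.
- by rewrite muln_gt0 X0; apply/card_gt0P; exists [ffun=> false].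
- by split; apply: lift_labelling.
- exact: tree_like_lift.
Qed.

Lemma labelled_achievable l X (G : dart_graph) (lab : labelling l X G) depth :
  tree_like G (2 * (depth + (5 * l + 5)) + 2) ->
  achievable (3 * l * X) ((5 * l + 1) * X)
   ((l * X)%:R * (source_energy R true + 2 * source_energy R false
      + 3 * ((5 * l + 5)%:R * 2^-1 ^+ depth))).
Proof.
move=> tree; exists G, (tree_flow R lab depth); split.
- exact: card_inner lab.
- exact: card_forward lab.
- split; first by move=> x d; apply: spread_flip.
  by move=> x z; apply: tree_flow_divergence.
set delta := _ * 2^-1 ^+ depth.
apply: (@le_trans _ _ (\sum_x (source_energy R (inner_quad lab x) + delta))).
  apply: ler_sum => x _; rewrite -(ler_pM2l (ltr0Sn R 1)).
  apply: le_trans _ (tree_flow_energy R lab x tree).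
  rewrite [leRHS](bigID (@forward G)) /= mulr_natl mulr2n lerD2l.
  rewrite -sum_forward; apply: ler_sum => d _.
  by rewrite [tree_flow _ _ _ _ (flip d)]spread_flip sqrrN.
rewrite (bigID (inner_quad lab)) /=.
rewrite (eq_bigr (fun=> source_energy R true + delta)); last by move=> x ->.
rewrite [X in _ + X](eq_bigr (fun=> source_energy R false + delta)); last first.
  by move=> x /negPf->.
rewrite !sumr_const.
have quadE : #|[pred z | inner_quad lab z]| = (l * X)%N := card_inner_quad lab.
have -> : #|[pred x | ~~ inner_quad lab x]| = (2 * (l * X))%N.
  have := cardC (inner_quad lab); rewrite (card_inner lab).
  rewrite (_ : #|inner_quad lab| = (l * X)%N) //.
  by rewrite (_ : #|[predC inner_quad lab]| = #|[pred x | ~~ inner_quad lab x]|) //; lia.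
rewrite (_ : #|[pred i | inner_quad lab i]| = (l * X)%N) //.
rewrite -[X in X + _]mulr_natl -[X in _ + X]mulr_natl (natrM _ 2); lra.
Qed.

(** [1773 / 2500] is twice 0.3546, since one more edge per vertex raises the mean degree by 2.
    [539 / 380] exceeds [1773 / 1250] by more than 1/50000, which times [L] outweighs the tails
    [3 * e] and the [+ 1] in the edge count. *)
Lemma savings_bound (L X q e : R) : 0 < X -> 100 * 1000 <= L -> e <= 1 / 1000 / 1000 ->
  q <= 3 - 539 / 380 ->
  1773 / 2500 * ((5 * L + 1) * X - 3 * L * X) <= 3 * L * X - L * X * (q + 3 * e).
Proof.
move=> X0 L0 e0 q0; rewrite -subr_ge0.
have -> : 3 * L * X - L * X * (q + 3 * e) - 1773 / 2500 * ((5 * L + 1) * X - 3 * L * X)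
    = X * (L * (3 - q - 3 * e) - 1773 / 1250 * (L + 1 / 2)) by field.
apply: mulr_ge0; [exact: ltW | rewrite subr_ge0].
apply: (@le_trans _ _ (L * (539 / 380 - 3 * (1 / 1000 / 1000)))); last by apply: ler_wpM2l; lra.
lra.
Qed.

(** The third condition says [2 * m / n] is at least 10/3, so that one graph serves the whole range
    of [alpha]. *)
Lemma efficient_graph : exists n m S, [/\ achievable n m S, (n < m)%N,
  (10 * n <= 6 * m)%N & 1773 / 2500 * (m%:R - n%:R) <= n%:R - S].
Proof.
have [l lE] : exists l, l.+1 = (100 * 1000)%N.
  by exists (100 * 1000).-1%N; rewrite prednK ?muln_gt0.
(* Since [2 ^ depth] exceeds [depth], this makes the tail at most one millionth. *)
pose depth := ((5 * l.+1 + 5) * (1000 * 1000))%N.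
have [X [G [X0 [lab] tree]]] := labelled_tree_like l (2 * (depth + (5 * l.+1 + 5)) + 2).
have := labelled_achievable lab tree.
set n := (3 * _ * X)%N; set m := (_ * X)%N; set S := _ * _ => a.
exists n, m, S; split=> //.
- by rewrite /n /m ltn_pmul2r //; lia.
- by rewrite /n /m !mulnA leq_pmul2r //; lia.
have delta : (5 * l.+1 + 5)%:R * 2^-1 ^+ depth <= 1 / 1000 / 1000 :> R.
  have -> : 1 / 1000 / 1000 = 1 / (1000 * 1000)%:R :> R by rewrite natrM; field.
  rewrite exprVn ler_pdivrMr ?exprn_gt0 // mulrC mulrA ler_pdivlMr ?ltr0n // mulr1.
  by rewrite -!natrX -natrM ler_nat; apply/ltnW/ltn_expl.
have LR : l.+1%:R = 100 * 1000 :> R by rewrite lE natrM.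
have -> : n%:R = 3 * l.+1%:R * X%:R :> R by rewrite !natrM.
have -> : m%:R = (5 * l.+1%:R + 1) * X%:R :> R by rewrite natrM natrD natrM.
rewrite /S (natrM _ l.+1); apply: savings_bound; rewrite ?ltr0n ?LR //.
exact: source_energy_mean.
Qed.

End Achievable.

(** * From flows to resistances *)

Section Thomson.
Variables (R : realType) (G : multigraph).
Implicit Types (x y z : vertex G) (theta : edge G -> R).

Definition unit_flow x y theta := forall z,
  \sum_(e | src e == z) theta e - \sum_(e | dst e == z) theta e
    = (z == x)%:R - (z == y)%:R.

(** Summation by parts. *)
Lemma unit_flow_pairing x y theta (f : vertex G -> R) : unit_flow x y theta ->
  \sum_e theta e * (f (src e) - f (dst e)) = f x - f y.
Proof.
move=> flow.
transitivity (\sum_z f z * ((z == x)%:R - (z == y)%:R)); last first.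
  have pick1 a : \sum_z f z * (z == a)%:R = f a.
    by rewrite (bigD1 a) //= eqxx mulr1 big1 ?addr0 // => z /negPf->; rewrite mulr0.
  by under eq_bigr do rewrite mulrBr; rewrite sumrB !pick1.
have gather (g : edge G -> vertex G) :
    \sum_e theta e * f (g e) = \sum_z f z * \sum_(e | g e == z) theta e.
  under [RHS]eq_bigr do rewrite mulr_sumr.
  rewrite (exchange_big_dep predT) //=; apply: eq_bigr => e _.
  by rewrite (big_pred1 (g e)) 1?mulrC // => z; rewrite eq_sym.
transitivity (\sum_e theta e * f (src e) - \sum_e theta e * f (dst e)).
  by rewrite -sumrB; apply: eq_bigr => e _; rewrite mulrBr.
rewrite !gather -sumrB; apply: eq_bigr => z _; by rewrite -flow mulrBr.
Qed.

(** The indicator of the component of [x] is constant along edges, so pairing the flow with it gives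
    0; hence it takes equal values at [x] and [y]. *)
Lemma unit_flow_connect x y theta : unit_flow x y theta ->
  connect (@Defs.adjacent G) x y.
Proof.
move/(unit_flow_pairing (fun z => (connect (@Defs.adjacent G) x z)%:R)).
rewrite big1 => [|e _]; last first.
  suff -> : connect (@Defs.adjacent G) x (src e) = connect (@Defs.adjacent G) x (dst e).
    by rewrite subrr mulr0.
  by apply/idP/idP => xe; apply: connect_trans xe (connect1 _); apply/existsP;
    exists e; rewrite !eqxx ?orbT.
rewrite connect0; case: connect => // /eqP.
by rewrite subr0 eq_sym oner_eq0.
Qed.

(* Thomson's principle: pairing the flow [theta] and the current [c] with the
   potential gives [sum theta c = sum c^2 = resistance], and [2 theta c] is at
   most [theta^2 + c^2].  If there were no potential, [xget] would return [0]. *)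
Lemma resistance_le_energy x y theta : unit_flow x y theta ->
  (resistance R x y <= (\sum_e theta e ^+ 2)%:E)%E.
Proof.
move=> flow; rewrite /resistance (unit_flow_connect flow) lee_fin.
case: xgetP => [v _ Kv|_]; last by rewrite subrr sumr_ge0 // => e _; apply: sqr_ge0.
set r := v x - v y.
have flowE : \sum_e theta e * current v e = r by apply: unit_flow_pairing.
have currentE : \sum_e current v e ^+ 2 = r.
  by rewrite /r -(unit_flow_pairing v Kv); apply: eq_bigr => e _; rewrite expr2.
have : 0 <= \sum_e (theta e - current v e) ^+ 2.
  by apply: sumr_ge0 => e _; apply: sqr_ge0.
under eq_bigr do rewrite sqrrB.
rewrite big_split /= sumrB currentE sumrMnl flowE mulr2n; lra.
Qed.

End Thomson.

Lemma sum_sqrB (R : comPzRingType) (T : finType) (a : T -> R) :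
  \sum_x \sum_y (a x - a y) ^+ 2
    = 2 * (#|T|%:R * \sum_x a x ^+ 2) - 2 * (\sum_x a x) ^+ 2.
Proof.
transitivity (\sum_x (a x ^+ 2 *+ #|T| + \sum_y a y ^+ 2 - 2 * (a x * \sum_y a y))).
  apply: eq_bigr => x _; rewrite !mulr_sumr -sumr_const -big_split -sumrB /=.
  by apply: eq_bigr => y _; rewrite sqrrB mulr_natl addrAC.
rewrite sumrB big_split /= sumrMnl sumr_const -mulr_sumr -mulr_suml -expr2.
by rewrite -mulr2n [#|T|%:R * _]mulr_natl [in RHS]mulr_natl.
Qed.

Section Rooted.
Variables (R : realType) (G : dart_graph).

Lemma edge_ends_neq (e : {d : dart G | forward d}) :
  start (val e) != start (flip (val e)).
Proof. by rewrite eq_sym start_flip_neq. Qed.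

Definition rooted_graph : multigraph :=
  @Multigraph (option (inner G)) {d : dart G | forward d}
    (fun e => start (val e)) (fun e => start (flip (val e))) edge_ends_neq.

Lemma sum_edge (P : pred (dart G)) (F : dart G -> R) :
  \sum_(e : edge rooted_graph | P (val e)) F (val e) = \sum_(d | forward d && P d) F d.
Proof. by apply/esym; exact: big_sub_cond. Qed.

Variables (theta : inner G -> dart G -> R) (flows : root_flows theta).

Definition edge_flow (x : option (inner G)) (e : edge rooted_graph) : R :=
  if x is Some x then theta x (val e) else 0.

(** [root_flows] imposes Kirchhoff's law only at inner vertices; at the root it follows because the
    divergences sum to 0. *)
Lemma edge_flow_unit (x : vertex rooted_graph) :
  unit_flow x (None : vertex rooted_graph) (edge_flow x).
Proof.
case: x => [x|] z; last by rewrite !big1_eq !subrr.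
have [anti kirchhoff] := flows.
pose div (v : vertex rooted_graph) := \sum_(e | src e == v) edge_flow (Some x) e
  - \sum_(e | dst e == v) edge_flow (Some x) e.
have inner_div y : div (Some y) = (y == x)%:R.
  rewrite /div [X in X - _](sum_edge (fun d => start d == Some y) (theta x)).
  rewrite [X in _ - X](sum_edge (fun d => start (flip d) == Some y) (theta x)).
  rewrite -kirchhoff [RHS](bigID (@forward G)) /= -sumrN.
  congr (_ + _); first by apply: eq_bigl => d; rewrite andbC.
  rewrite [RHS](reindex_inj (@flip_inj G)) /=; apply: eq_big => d.
    by rewrite forward_flip negbK andbC.
  by rewrite anti.
rewrite -/(div z); case: z => [y|]; first by rewrite inner_div subr0.
have total : \sum_v div v = 0.
  rewrite sumrB; apply/eqP; rewrite subr_eq0; apply/eqP.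
  transitivity (\sum_e edge_flow (Some x) e); first apply/esym;
    exact: (partition_big _ predT).
move: total; rewrite (bigD1 None) //= (bigD1 (Some x)) //= inner_div eqxx.
rewrite big1 => [|[z|] // /andP[_ zx]]; last first.
  by rewrite inner_div -(inj_eq Some_inj) (negPf zx).
by rewrite addr0 sub0r => /eqP; rewrite addr_eq0 => /eqP.
Qed.

Definition total_energy := \sum_x \sum_(d | forward d) theta x d ^+ 2.

Lemma edge_flow_energy : \sum_x \sum_e edge_flow x e ^+ 2 = total_energy.
Proof.
rewrite (bigD1 None) //= big1 => [|e _]; last by rewrite expr0n.
rewrite add0r (reindex_omap Some id) => [|[x|]] //=.
under eq_bigl do rewrite eqxx; apply: eq_bigr => x _.
rewrite [LHS](sum_edge predT (fun d => theta x d ^+ 2)).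
by under eq_bigl do rewrite andbT.
Qed.

Lemma edge_flowB_unit (x y : vertex rooted_graph) :
  unit_flow x y (fun e => edge_flow x e - edge_flow y e).
Proof.
move=> z; rewrite !sumrB.
have := edge_flow_unit x z; have := edge_flow_unit y z; lra.
Qed.

Lemma rooted_mean_resistance_le :
  (rooted_mean_resistance R (None : vertex rooted_graph)
    <= (total_energy / #|inner G|%:R)%:E)%E.
Proof.
rewrite /rooted_mean_resistance card_option -natr1 addrK.
rewrite mulrC EFinM lee_wpmul2l ?lee_fin ?invr_ge0 //.
rewrite -edge_flow_energy -sumEFin; apply: lee_sum => x _.
have -> : \sum_e edge_flow x e ^+ 2 = \sum_e (edge_flow None e - edge_flow x e) ^+ 2.
  by apply: eq_bigr => e _; rewrite sub0r sqrrN.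
exact/resistance_le_energy/edge_flowB_unit.
Qed.

Lemma mean_resistance_le :
  (mean_resistance R rooted_graph <= (2 * total_energy / #|inner G|.+1%:R)%:E)%E.
Proof.
rewrite /mean_resistance card_option.
have N0 : #|inner G|.+1%:R != 0 :> R by rewrite pnatr_eq0.
move: N0; set N : R := _%:R => N0.
have -> : 2 * total_energy / N = (N ^+ 2)^-1 * (2 * (N * total_energy)).
  by field.
rewrite EFinM lee_wpmul2l ?lee_fin ?invr_ge0 ?exprn_ge0 //.
apply: (@le_trans _ _ (\sum_x \sum_y \sum_e (edge_flow x e - edge_flow y e) ^+ 2)%:E).
  rewrite -sumEFin; apply: lee_sum => x _; rewrite -sumEFin; apply: lee_sum => y _.
  exact/resistance_le_energy/edge_flowB_unit.
rewrite lee_fin -edge_flow_energy.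
under eq_bigr do rewrite exchange_big; rewrite exchange_big /=.
rewrite [X in N * X]exchange_big !mulr_sumr; apply: ler_sum => e _.
(* Edge by edge, the squared total flow enters with a negative sign and is dropped. *)
rewrite sum_sqrB card_option lerBlDr lerDl mulr_ge0 ?sqr_ge0 //.
Qed.

End Rooted.

(** * Limits *)

Section Minima.
Local Open Scope classical_set_scope.
Local Open Scope ring_scope.
Variable R : realType.
Implicit Types (n m : nat) (S alpha : R).

Lemma b_min_le n m S alpha : achievable n m S -> m%:R <= alpha * n%:R / 2 ->
  (b_min n alpha <= (S / n%:R)%:E)%E.
Proof.
move=> [G [theta [<- mE flows energy]]] m_le.
apply: le_trans (_ : (total_energy theta / #|inner G|%:R)%:E <= _)%E; last first.
  by rewrite lee_fin ler_wpM2r ?invr_ge0.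
apply: le_trans (rooted_mean_resistance_le flows).
apply: ereal_inf_lbound; exists (rooted_graph G), None; split=> //=.
  by rewrite card_option.
by rewrite card_sig mE.
Qed.

Lemma a_min_le n m S alpha : achievable n m S -> m%:R <= alpha * n.+1%:R / 2 ->
  (a_min n.+1 alpha <= (2 * S / n.+1%:R)%:E)%E.
Proof.
move=> [G [theta [<- mE flows energy]]] m_le.
apply: le_trans (_ : (2 * total_energy theta / #|inner G|.+1%:R)%:E <= _)%E; last first.
  by rewrite lee_fin ler_wpM2r ?invr_ge0 ?ler_pM2l.
apply: le_trans (mean_resistance_le flows).
apply: ereal_inf_lbound; exists (rooted_graph G); split=> //=.
  by rewrite card_option.
by rewrite card_sig mE.
Qed.

(** A pendant edge costs one edge per vertex, and each copy of the efficient graph [m - k] edges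
    more; [t] is the number of copies the edge budget allows. Rounding [t] down loses less than the
    saving guaranteed for one copy, which is [K]. *)
Lemma mixed_graph : exists2 K : R, 0 <= K & forall alpha n, 2 <= alpha <= 10 / 3 ->
  exists m S, [/\ achievable n m S, m%:R <= alpha * n%:R / 2
    & S <= n%:R * (1 - 3546 / 10 ^+ 4 * (alpha - 2)) + K].
Proof.
have [k [m [S [aG km m_ge savings]]]] := efficient_graph R.
have mk0 : 0 < m%:R - k%:R :> R by rewrite subr_gt0 ltr_nat.
exists (1773 / 2500 * (m%:R - k%:R)); first by apply: mulr_ge0; [lra | exact: ltW].
move=> alpha n /andP[alpha2 alpha_le].
pose t : R := (alpha / 2 - 1) * n%:R / (m%:R - k%:R).
have t0 : 0 <= t by rewrite divr_ge0 ?(ltW mk0) // mulr_ge0 //; lra.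
pose p := Num.truncn t.
have /andP[p_le p_gt] := truncn_itv t0; rewrite -/p -natr1 in p_le p_gt.
have p_le' : p%:R * (m%:R - k%:R) <= (alpha / 2 - 1) * n%:R by rewrite -ler_pdivlMr.
have p_gt' : (alpha / 2 - 1) * n%:R < (p%:R + 1) * (m%:R - k%:R) by rewrite -ltr_pdivrMr.
(* The copies fit because [alpha / 2 - 1] is at most 2/3 and [k] at most [3 / 2 * (m - k)]. *)
have pk_n : (p * k <= n)%N.
  have mkR : 10 * k%:R <= 6 * m%:R :> R by rewrite -!natrM ler_nat.
  rewrite -(ler_nat R) natrM.
  apply: (@le_trans _ _ (p%:R * (3 / 2 * (m%:R - k%:R)))).
    by rewrite ler_wpM2l //; lra.
  have : (alpha / 2 - 1) * n%:R <= 2 / 3 * n%:R by rewrite ler_wpM2r //; lra.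
  lra.
exists (p * m + (n - p * k))%N, (p%:R * S + (n - p * k)%:R); split.
- rewrite -[X in achievable X](subnKC pk_n); apply: achievableD; first exact: achievableM.
  by have := achievableM (n - p * k) (achievable1 R); rewrite !muln1 mulr1.
- by rewrite natrD natrB // !natrM; lra.
rewrite natrB // natrM.
have : p%:R * (1773 / 2500 * (m%:R - k%:R)) <= p%:R * (k%:R - S) by rewrite ler_wpM2l.
have -> : 3546 / 10 ^+ 4 = 1773 / 5000 :> R by field.
lra.
Qed.

(* If [u] diverges, [limn u] is the default value [0]. *)
Lemma limn_le_harmonic (u : nat -> \bar R) c K : 0 <= c ->
  (forall n, (u n.+1 <= (c + K / n.+1%:R)%:E)%E) -> (limn u <= c%:E)%E.
Proof.
move=> c0 u_le; have [cu|/dvgP->] := pselect (cvgn u); last by rewrite lee_fin.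
have v_cvg : ((fun n => (c + K * harmonic n)%:E) @ \oo --> c%:E).
  apply: cvg_EFin; first exact: nearW.
  rewrite -[X in _ --> X]addr0 -[X in _ + X](mulr0 K).
  by apply: cvgD; [exact: cvg_cst | apply: cvgMr; exact: cvg_harmonic].
have u_cvg : ((fun n => u n.+1) @ \oo --> limn u) by rewrite cvg_shiftS.
rewrite -(cvg_lim _ u_cvg) // -(cvg_lim _ v_cvg) //; apply: lee_lim.
- by apply/cvg_ex; exists (limn u).
- by apply/cvg_ex; exists c%:E.
- by apply: nearW => n; apply: u_le.
Qed.

Lemma b_lim_le alpha : 2 <= alpha <= 10 / 3 ->
  (b_lim alpha <= (1 - 3546 / 10 ^+ 4 * (alpha - 2))%:E)%E.
Proof.
move=> alphaP; have [K K0 mixed] := mixed_graph.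
apply: (@limn_le_harmonic _ _ K).
  have -> : 3546 / 10 ^+ 4 = 1773 / 5000 :> R by field.
  by case/andP: alphaP; lra.
move=> n; have [m [S [a m_le S_le]]] := mixed alpha n.+1 alphaP.
apply: le_trans (b_min_le a m_le) _.
rewrite lee_fin ler_pdivrMr ?ltr0n // [leRHS]mulrDl divfK ?pnatr_eq0 //.
by rewrite mulrC.
Qed.

Lemma a_lim_le alpha : 2 <= alpha <= 10 / 3 ->
  (a_lim alpha <= (2 * (1 - 3546 / 10 ^+ 4 * (alpha - 2)))%:E)%E.
Proof.
move=> alphaP; have [K K0 mixed] := mixed_graph.
have c0 : 0 <= 1 - 3546 / 10 ^+ 4 * (alpha - 2).
  have -> : 3546 / 10 ^+ 4 = 1773 / 5000 :> R by field.
  by case/andP: alphaP; lra.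
apply: (@limn_le_harmonic _ _ (2 * K)); first by rewrite mulr_ge0.
(* The root now counts as an ordinary vertex, so [n] inner vertices serve for [a_min n.+1]. *)
move=> n; have [m [S [a m_le S_le]]] := mixed alpha n alphaP.
apply: le_trans (a_min_le a _) _.
  by apply: le_trans m_le _; rewrite -(natr1 n); case/andP: alphaP; lra.
rewrite lee_fin ler_pdivrMr ?ltr0n // [leRHS]mulrDl divfK ?pnatr_eq0 //.
by rewrite -(natr1 n); lra.
Qed.

End Minima.

Theorem theorem12 (R : realType) :
  (forall alpha : R, 2 <= alpha <= 10 / 3 ->
     (b_lim alpha <= (1 - 3546 / 10 ^+ 4 * (alpha - 2))%:E)%E) /\
  (b_lim (3 : R) <= (6454 / 10 ^+ 4)%:E)%E /\
  (a_lim (3 : R) <= (12908 / 10 ^+ 4)%:E)%E.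
Proof.
have alpha3 : 2 <= (3 : R) <= 10 / 3 by lra.
split; first exact: b_lim_le; split.
  by apply: le_trans (b_lim_le alpha3) _; rewrite lee_fin; lra.
by apply: le_trans (a_lim_le alpha3) _; rewrite lee_fin; lra.
Qed.
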